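(* Let $G$ be a finite group with regular representation $\rho_{\mathrm{reg}}$, and let $\mathcal{R}$ be a set of finite-dimensional representations of $G$ closed under tensor product, containing the trivial representation and $\rho_{\mathrm{reg}}$. Then for all $\sigma\in\hat{\mathcal{R}}$ and $\sigma'\in\mathcal{R}$ one has $\sigma/\sigma'=\dim(\sigma)/\dim(\sigma')$ in the algebraic localization $\mathcal{R}^{-1}\hat{\mathcal{R}}$; consequently $\mathcal{R}^{-1}\hat{\mathcal{R}}/X_G$ is isomorphic to a multiplicative group of positive rationals (the localization $\dim(\mathcal{R})^{-1}\dim(\hat{\mathcal{R}})$, a subgroup of $\mathbb{Q}^\times$), and the classification of one-dimensional $G$-symmetric QCA reduces to a subgroup of $H^2(G;U(1))\oplus\log\mathbb{Q}^\times$.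
   Context: $\hat{\mathcal{R}}=\{v\in\mathrm{Rep}(G):\exists\rho,\ v\otimes\rho\in\mathcal{R}\}$. The algebraic localization consists of formal fractions $v/\rho$ ($v\in\hat{\mathcal{R}}$, $\rho\in\mathcal{R}$) modulo $(v_1,\rho_1)\sim(v_2,\rho_2)$ iff there is $\tau\in\mathcal{R}$ with $\tau\otimes v_1\otimes\rho_2\simeq\tau\otimes v_2\otimes\rho_1$ (unitary equivalence). $X_G$ is the group of one-dimensional representations. $\dim(\sigma)$ is identified with the direct sum of $\dim\sigma$ copies of the trivial representation. *)

(* Defs.v *)
From HB Require Import structures.
From mathcomp Require Import all_boot all_order all_algebra all_fingroup.
From mathcomp Require Import mxrepresentation algC spectral.
Set Implicit Arguments. Unset Strict Implicit. Unset Printing Implicit Defensive.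
Import Order.TTheory GRing.Theory Num.Theory.
Local Open Scope ring_scope.

Record rrep (gT : finGroupType) := RRep { rdim : nat; rmx : gT -> 'M[algC]_rdim }.

(* Kronecker (tensor) product of matrices: the matrix, in the mxvec basis of
   'M_(m,n) ~ C^m (x) C^n, of X |-> A^T X B; its ((i1,i2),(j1,j2)) entry is
   A i1 j1 * B i2 j2 (row-vector convention, as in mathcomp). *)
Definition tensmx m n (A : 'M[algC]_m) (B : 'M[algC]_n) : 'M[algC]_(m * n) :=
  lin_mx (fun X : 'M[algC]_(m, n) => A^T *m X *m B).

Section Reps.
Variables (gT : finGroupType) (G : {group gT}).

Definition is_urep (r : rrep gT) : Prop :=
  [/\ (0 < rdim r)%N, mx_repr G (@rmx gT r)
    & {in G, forall g, @rmx gT r g \is unitarymx}].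

Definition rtensor (a b : rrep gT) : rrep gT :=
  @RRep gT (rdim a * rdim b) (fun g => tensmx (rmx a g) (rmx b g)).

(* Direct sum of n copies of the trivial representation (= dim identified
   with a representation); trivial representation is triv_rep 1. *)
Definition triv_rep (n : nat) : rrep gT := @RRep gT n (fun _ => 1%:M).

Definition reg_rep : rrep gT := @RRep gT #|G| (regular_repr algC G).

Definition ueq (a b : rrep gT) : Prop :=
  rdim a = rdim b /\
  exists U : 'M[algC]_(rdim a, rdim b),
    U \is unitarymx /\ {in G, forall g, rmx a g *m U = U *m rmx b g}.

Definition Rhat (R : rrep gT -> Prop) (v : rrep gT) : Prop :=
  is_urep v /\ exists rho, R rho /\ R (rtensor v rho).

(* Equality of formal fractions v1/rho1 = v2/rho2 in the algebraic
   localization R^{-1} R-hat. *)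
Definition frac_eq (R : rrep gT -> Prop) (v1 rho1 v2 rho2 : rrep gT) : Prop :=
  exists tau, R tau /\
    ueq (rtensor (rtensor tau v1) rho2) (rtensor (rtensor tau v2) rho1).

End Reps.

(* Main.v *)
Require Import Defs.
From HB Require Import structures.
From mathcomp Require Import all_boot all_order all_algebra all_fingroup.
From mathcomp Require Import mxrepresentation algC spectral.
Set Implicit Arguments. Unset Strict Implicit. Unset Printing Implicit Defensive.
Import Order.TTheory GRing.Theory Num.Theory.
Local Open Scope ring_scope.
Local Open Scope sesquilinear_scope.

(* Fell's absorption principle: for a unitary representation V of G, the
   block-diagonal matrix e_g (x) v |-> e_g (x) V(g)^-1 v is a unitary
   intertwiner from rho_reg (x) V to rho_reg (x) 1^(dim V). Up to the
   associator, rho_reg (x) v (x) rho is thus unitarily equivalent to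
   rho_reg (x) 1^(dim v * dim rho), so tau = rho_reg witnesses v1/rho1 = v2/rho2
   whenever dim v1 * dim rho2 = dim v2 * dim rho1. Conversely, a unitary
   equivalence preserves dimensions and every tau in R has positive
   dimension. *)

Section MxvecIndex.
Variables m n : nat.

Lemma mxvec_index_pair_inj :
  injective (fun ij : 'I_m * 'I_n => mxvec_index ij.1 ij.2).
Proof. by move=> [i j] [k l] /cast_ord_inj/enum_rank_inj. Qed.

Lemma eq_mxvec_index (i k : 'I_m) (j l : 'I_n) :
  (mxvec_index i j == mxvec_index k l) = (i == k) && (j == l).
Proof. exact: (inj_eq mxvec_index_pair_inj (i, j) (k, l)). Qed.

Lemma big_mxvec (V : nmodType) (F : 'I_(m * n) -> V) :
  \sum_k F k = \sum_i \sum_j F (mxvec_index i j).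
Proof.
rewrite pair_bigA /= (reindex (fun ij => mxvec_index ij.1 ij.2)) //.
apply/onW_bij/inj_card_bij; first exact: mxvec_index_pair_inj.
by rewrite card_prod !card_ord.
Qed.

Lemma mxvec_matrixP (T : Type) p q (A B : 'M[T]_(m * n, p * q)) :
  (forall i j k l, A (mxvec_index i j) (mxvec_index k l)
                 = B (mxvec_index i j) (mxvec_index k l)) -> A = B.
Proof.
move=> eqAB; apply/matrixP => x y.
by case/mxvec_indexP: x => i j; case/mxvec_indexP: y => k l.
Qed.

Lemma lin_mx_mxvecE (R : pzRingType) p q
    (f : 'M[R]_(m, n) -> 'M[R]_(p, q)) i j k l :
  lin_mx f (mxvec_index i j) (mxvec_index k l) = f (delta_mx i j) k l.
Proof. by rewrite mxE /= vec_mx_delta mxvecE. Qed.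

End MxvecIndex.

Section Kronecker.
Variables m n : nat.
Implicit Types (A C : 'M[algC]_m) (B D : 'M[algC]_n).

Lemma tensmxE A B i j k l :
  tensmx A B (mxvec_index i j) (mxvec_index k l) = A i k * B j l.
Proof.
rewrite lin_mx_mxvecE -(mul_delta_mx (0 : 'I_1)) mulmxA -colE -mulmxA -rowE.
by rewrite mxE big_ord1 !mxE.
Qed.

Lemma tensmx_mul A B C D : tensmx A B *m tensmx C D = tensmx (A *m C) (B *m D).
Proof.
apply: mxvec_matrixP => i j k l; rewrite mxE big_mxvec tensmxE !mxE big_distrl.
apply: eq_bigr => x _; rewrite big_distrr; apply: eq_bigr => y _.
by rewrite !tensmxE mulrACA.
Qed.

Lemma tensmx1 : tensmx (1%:M : 'M_m) (1%:M : 'M_n) = 1%:M.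
Proof.
apply: mxvec_matrixP => i j k l.
by rewrite tensmxE !mxE eq_mxvec_index -natrM mulnb.
Qed.

Lemma tensmx_adj A B : (tensmx A B)^t* = tensmx (A^t*) (B^t*).
Proof.
apply: mxvec_matrixP => i j k l.
by rewrite [LHS]mxE [X in X^*]mxE !tensmxE rmorphM !mxE.
Qed.

Lemma tensmx_unitary A B :
  A \is unitarymx -> B \is unitarymx -> tensmx A B \is unitarymx.
Proof.
move=> /unitarymxP uA /unitarymxP uB; apply/unitarymxP.
by rewrite tensmx_adj tensmx_mul uA uB tensmx1.
Qed.

End Kronecker.

Section Associator.
Variables m n p : nat.

Definition tensmx_assoc : 'M[algC]_(m * n * p, m * (n * p)) :=
  lin_mx (fun X : 'M_(m * n, p) =>
    \matrix_i mxvec (\matrix_(j, k) X (mxvec_index i j) k)).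

Lemma row_tensmx_assoc i j k :
  row (mxvec_index (mxvec_index i j) k) tensmx_assoc
  = delta_mx 0 (mxvec_index i (mxvec_index j k)).
Proof.
apply/rowP => x; case/mxvec_indexP: x => i' x; case/mxvec_indexP: x => j' k'.
by rewrite mxE lin_mx_mxvecE !mxE mxvecE !mxE !eq_mxvec_index /= andbA.
Qed.

Lemma col_tensmx_assoc i j k :
  col (mxvec_index i (mxvec_index j k)) tensmx_assoc
  = delta_mx (mxvec_index (mxvec_index i j) k) 0.
Proof.
apply/colP => x; case/mxvec_indexP: x => x k'; case/mxvec_indexP: x => i' j'.
rewrite mxE lin_mx_mxvecE !mxE mxvecE !mxE !eq_mxvec_index eqxx andbT.
by rewrite (eq_sym i) (eq_sym j) (eq_sym k).
Qed.

Lemma mulmx_tensmx_assocE q (M : 'M[algC]_(q, m * n * p)) x i j k :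
  (M *m tensmx_assoc) x (mxvec_index i (mxvec_index j k))
  = M x (mxvec_index (mxvec_index i j) k).
Proof.
have := congr1 (fun X => (M *m X) x 0) (col_tensmx_assoc i j k).
by rewrite /= colE mulmxA -!colE !mxE.
Qed.

Lemma tensmx_assoc_mulmxE q (M : 'M[algC]_(m * (n * p), q)) i j k y :
  (tensmx_assoc *m M) (mxvec_index (mxvec_index i j) k) y
  = M (mxvec_index i (mxvec_index j k)) y.
Proof.
have := congr1 (fun X => (X *m M) 0 y) (row_tensmx_assoc i j k).
by rewrite /= rowE -mulmxA -!rowE !mxE.
Qed.

Lemma tensmx_assoc_unitary : tensmx_assoc \is unitarymx.
Proof.
apply/row_unitarymxP => x y.
case/mxvec_indexP: x => x k; case/mxvec_indexP: x => i j.
case/mxvec_indexP: y => y k'; case/mxvec_indexP: y => i' j'.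
rewrite !row_tensmx_assoc dotmxE -rowE !mxE conjC_nat.
by rewrite !eq_mxvec_index eqxx /= andbA.
Qed.

Lemma tensmx_assocP (A : 'M[algC]_m) (B : 'M[algC]_n) (C : 'M[algC]_p) :
  tensmx (tensmx A B) C *m tensmx_assoc = tensmx_assoc *m tensmx A (tensmx B C).
Proof.
apply: mxvec_matrixP => x k i' y.
case/mxvec_indexP: x => i j; case/mxvec_indexP: y => j' k'.
by rewrite mulmx_tensmx_assocE tensmx_assoc_mulmxE !tensmxE mulrA.
Qed.

End Associator.

Section BlockDiagonal.
Variables p n : nat.
Implicit Types M : 'I_p -> 'M[algC]_n.

Definition bdiag M : 'M[algC]_(p * n) := \sum_g tensmx (delta_mx g g) (M g).

Lemma bdiagE M g i g' k :
  bdiag M (mxvec_index g i) (mxvec_index g' k) = (g == g')%:R * M g i k.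
Proof.
rewrite summxE (bigD1 g) //= big1 => [|x /negbTE ne_xg].
  by rewrite tensmxE mxE eqxx eq_sym addr0.
by rewrite tensmxE mxE eq_sym ne_xg mul0r.
Qed.

Lemma mul_tensmx_bdiag (P : 'M_p) (Q : 'M_n) M g i g' k :
  (tensmx P Q *m bdiag M) (mxvec_index g i) (mxvec_index g' k)
  = P g g' * (Q *m M g') i k.
Proof.
rewrite mxE big_mxvec (bigD1 g') //= [X in _ + X]big1 ?addr0
  => [|x /negbTE ne_xg].
  rewrite mxE big_distrr; apply: eq_bigr => y _.
  by rewrite tensmxE bdiagE eqxx mul1r -mulrA.
by apply: big1 => y _; rewrite bdiagE ne_xg mul0r mulr0.
Qed.

Lemma mul_bdiag_tensmx (P : 'M_p) (Q : 'M_n) M g i g' k :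
  (bdiag M *m tensmx P Q) (mxvec_index g i) (mxvec_index g' k)
  = P g g' * (M g *m Q) i k.
Proof.
rewrite mxE big_mxvec (bigD1 g) //= [X in _ + X]big1 ?addr0 => [|x ne_xg].
  rewrite mxE big_distrr; apply: eq_bigr => y _.
  by rewrite tensmxE bdiagE eqxx mul1r mulrCA.
by apply: big1 => y _; rewrite bdiagE eq_sym (negbTE ne_xg) mul0r mul0r.
Qed.

Lemma bdiag_unitary M : (forall g, M g \is unitarymx) -> bdiag M \is unitarymx.
Proof.
move=> M_unitary; apply/unitarymxP; apply: mxvec_matrixP => g i g' k.
rewrite mxE big_mxvec (bigD1 g) //= [X in _ + X]big1 ?addr0
  => [|x ne_xg]; last first.
  by apply: big1 => y _; rewrite bdiagE eq_sym (negbTE ne_xg) mul0r mul0r.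
under eq_bigr => y _ do rewrite [_^t* _ _]mxE [_^T _ _]mxE !bdiagE eqxx mul1r.
rewrite mxE eq_mxvec_index; have [<- | _] /= := eqVneq g g'.
  have /unitarymxP/matrixP/(_ i k) := M_unitary g.
  by rewrite !mxE => <-; apply: eq_bigr => y _; rewrite mul1r !mxE.
by rewrite big1 // => y _; rewrite mul0r conjC0 mulr0.
Qed.

End BlockDiagonal.

Section UnitaryEquivalence.
Variables (gT : finGroupType) (G : {group gT}).
Implicit Types a b c : rrep gT.

Lemma ueq_sym a b : ueq G a b -> ueq G b a.
Proof.
case: a b => m rho_a [n rho_b] [/= eq_mn]; subst n => -[U [U_unitary rho_aU]].
split=> //; exists (U^t*); split; first by rewrite trmxC_unitary.
move=> g Gg; have UU : U^t* *m U = 1%:M.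
  by rewrite -invmx_unitary // mulVmx // unitarymx_unit.
have := congr1 (fun X => U^t* *m X *m U^t*) (rho_aU g Gg).
by rewrite /= !mulmxA UU mul1mx -!mulmxA (unitarymxP U_unitary) mulmx1.
Qed.

Lemma ueq_trans a b c : ueq G a b -> ueq G b c -> ueq G a c.
Proof.
case=> eq_ab [U [U_unitary rho_U]] [eq_bc [V [V_unitary rho_V]]].
split; first exact: etrans eq_ab eq_bc.
exists (U *m V); split; first exact: mul_unitarymx.
by move=> g Gg; rewrite mulmxA rho_U // -!mulmxA rho_V.
Qed.

Lemma is_urep_rtensor a b :
  is_urep G a -> is_urep G b -> is_urep G (rtensor a b).
Proof.
case=> a_gt0 [a1 aM] a_unitary [b_gt0 [b1 bM] b_unitary].
split; first by rewrite muln_gt0 a_gt0.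
  split=> [|g h Gg Gh] /=; first by rewrite a1 b1 tensmx1.
  by rewrite aM // bM // tensmx_mul.
by move=> g Gg; apply: tensmx_unitary; [apply: a_unitary | apply: b_unitary].
Qed.

Lemma is_urep_triv n : (0 < n)%N -> is_urep G (triv_rep gT n).
Proof.
split=> //; first by split=> // g h _ _; rewrite mul1mx.
by move=> g _; apply/unitarymxP; rewrite trmx1 map_mx1 mul1mx.
Qed.

Lemma ueq_rtensorA a b c :
  ueq G (rtensor (rtensor a b) c) (rtensor a (rtensor b c)).
Proof.
split; first by rewrite /= mulnA.
exists (tensmx_assoc _ _ _); split; first exact: tensmx_assoc_unitary.
by move=> g _; apply: tensmx_assocP.
Qed.

End UnitaryEquivalence.

Section RegularAbsorption.
Variables (gT : finGroupType) (G : {group gT}).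

Definition reg_absorb_mx n (rho : gT -> 'M[algC]_n) : 'M_(#|G| * n) :=
  bdiag (fun g : 'I_#|G| => rho (enum_val g)^-1%g).

Lemma reg_absorb_mxP n (rG : mx_representation algC G n) h : h \in G ->
  tensmx (regular_repr algC G h) (rG h) *m reg_absorb_mx rG
  = reg_absorb_mx rG *m tensmx (regular_repr algC G h) 1%:M.
Proof.
move=> Gh; apply: mxvec_matrixP => g i g' k.
rewrite mul_tensmx_bdiag mul_bdiag_tensmx mulmx1 [regular_repr _ _ _ _ _]mxE mxE.
have [-> | _] /= := eqVneq g' (gring_index G (enum_val g * h)); last first.
  by rewrite !mul0r.
have Gg : enum_val g \in G by apply: enum_valP.
by rewrite gring_indexK ?groupM // -repr_mxM ?groupV ?groupM // invMg mulKVg.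
Qed.

Lemma reg_absorb_mx_unitary n (rho : gT -> 'M[algC]_n) :
  {in G, forall g, rho g \is unitarymx} -> reg_absorb_mx rho \is unitarymx.
Proof.
move=> rho_unitary; apply: bdiag_unitary => g.
by rewrite rho_unitary ?groupV ?enum_valP.
Qed.

Lemma ueq_reg_absorb v : is_urep G v ->
  ueq G (rtensor (reg_rep G) v) (rtensor (reg_rep G) (triv_rep gT (rdim v))).
Proof.
case: v => n rho [_ rho_repr rho_unitary]; split=> //.
exists (reg_absorb_mx rho); split; first exact: reg_absorb_mx_unitary.
by move=> h Gh; apply: (reg_absorb_mxP (MxRepresentation rho_repr)).
Qed.

Lemma ueq_reg_absorb2 a b : is_urep G a -> is_urep G b ->
  ueq G (rtensor (rtensor (reg_rep G) a) b)
        (rtensor (reg_rep G) (triv_rep gT (rdim a * rdim b))).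
Proof.
move=> a_urep b_urep; apply: ueq_trans (ueq_rtensorA _ _ _ _) _.
exact: ueq_reg_absorb (is_urep_rtensor a_urep b_urep).
Qed.

Lemma frac_eq_of_dims (R : rrep gT -> Prop) v1 rho1 v2 rho2 :
  R (reg_rep G) ->
  is_urep G v1 -> is_urep G rho1 -> is_urep G v2 -> is_urep G rho2 ->
  (rdim v1 * rdim rho2 = rdim v2 * rdim rho1)%N -> frac_eq G R v1 rho1 v2 rho2.
Proof.
move=> R_reg v1_urep rho1_urep v2_urep rho2_urep dims.
exists (reg_rep G); split=> //.
apply: ueq_trans (ueq_reg_absorb2 v1_urep rho2_urep) _; rewrite dims.
exact/ueq_sym/ueq_reg_absorb2.
Qed.

Lemma dims_of_frac_eq (R : rrep gT -> Prop) v1 rho1 v2 rho2 :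
  (forall tau, R tau -> (0 < rdim tau)%N) -> frac_eq G R v1 rho1 v2 rho2 ->
  (rdim v1 * rdim rho2 = rdim v2 * rdim rho1)%N.
Proof.
move=> R_gt0 [tau [/R_gt0 tau_gt0 [/= dims _]]].
by apply/eqP; rewrite -(eqn_pmul2l tau_gt0) !mulnA dims.
Qed.

End RegularAbsorption.

Theorem mainTheorem13 (gT : finGroupType) (G : {group gT})
    (R : rrep gT -> Prop)
    (HRrep : forall r, R r -> is_urep G r)
    (HRtens : forall a b, R a -> R b -> R (rtensor a b))
    (HRtriv : R (triv_rep gT 1))
    (HRreg : R (reg_rep G)) :
  (forall sigma sigma', Rhat G R sigma -> R sigma' ->
     frac_eq G R sigma sigma' (triv_rep gT (rdim sigma)) (triv_rep gT (rdim sigma')))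
  /\
  (forall v1 rho1 v2 rho2, Rhat G R v1 -> R rho1 -> Rhat G R v2 -> R rho2 ->
     (frac_eq G R v1 rho1 v2 rho2 <->
      (rdim v1 * rdim rho2 = rdim v2 * rdim rho1)%N)).
Proof.
have Rhat_urep v : Rhat G R v -> is_urep G v by case.
have R_gt0 tau : R tau -> (0 < rdim tau)%N by case/HRrep.
split=> [s s' /Rhat_urep s_urep /HRrep s'_urep | v1 rho1 v2 rho2].
  have [s_gt0 _ _] := s_urep; have [s'_gt0 _ _] := s'_urep.
  by apply: frac_eq_of_dims => //; apply: is_urep_triv.
move=> /Rhat_urep v1_urep /HRrep rho1_urep /Rhat_urep v2_urep /HRrep rho2_urep.
split; first exact: dims_of_frac_eq.
exact: frac_eq_of_dims.
Qed.
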